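(* Let $\xi\in\mathbb{R}$ be such that $1,\xi,\xi^3$ are linearly independent over $\mathbb{Q}$, let $\lambda,c>0$ be such that for each sufficiently large real number $X$ there exists a non-zero point $\mathbf{x}\in\mathbb{Z}^3$ with $\|\mathbf{x}\|\le X$ and $L(\mathbf{x})\le cX^{-\lambda}$, and let $(\mathbf{x}_i)_{i\ge1}$ be a sequence of minimal points for $(1,\xi,\xi^3)$. Suppose that $\lambda>(5-\sqrt{13})/2\cong 0.697$. Then $F_i\ne0$ for each sufficiently large element $i$ of $I$.
   Context: For $\mathbf{x}=(x_0,x_1,x_2)\in\mathbb{R}^3$, put $\|\mathbf{x}\|=\max\{|x_0|,|x_1|,|x_2|\}$ and $L(\mathbf{x})=\max\{|x_1-x_0\xi|,|x_2-x_0\xi^3|\}$. A sequence of minimal points for $(1,\xi,\xi^3)$ is a sequence $(\mathbf{x}_i)_{i\ge1}$ of non-zero points of $\mathbb{Z}^3$ such that, with $X_i=\|\mathbf{x}_i\|$ and $L_i=L(\mathbf{x}_i)$: (a) $X_1<X_2<X_3<\cdots$; (b) $1/2>L_1>L_2>L_3>\cdots$; (c) if $L(\mathbf{x})<L_i$ for some $\mathbf{x}\in\mathbb{Z}^3\setminus\{0\}$ and some $i\ge1$, then $\|\mathbf{x}\|\ge X_{i+1}$. $I$ is the set of integers $i\ge2$ such that $\mathbf{x}_{i-1},\mathbf{x}_i,\mathbf{x}_{i+1}$ are linearly independent; it is an infinite set, ordered increasingly. Put $$\varphi(\mathbf{x})=x_0^2x_2-x_1^3,\qquad \Phi(\mathbf{x},\mathbf{y},\mathbf{z})=x_0y_0z_2+x_0y_2z_0+x_2y_0z_0-3x_1y_1z_1,$$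 $$F(\mathbf{x},\mathbf{y})=\Phi(\mathbf{x},\mathbf{x},\mathbf{y})^2-4\varphi(\mathbf{x})\Phi(\mathbf{x},\mathbf{y},\mathbf{y}).$$ For $i\in I$, $F_i:=F(\mathbf{x}_i,\mathbf{x}_j)$ where $j$ is the successor of $i$ in $I$. *)

(* Defs.v *)
From HB Require Import structures.
From mathcomp Require Import all_boot all_order all_algebra.
From mathcomp Require Import all_classical all_reals all_analysis.

Set Implicit Arguments.
Unset Strict Implicit.
Unset Printing Implicit Defensive.

Import Order.TTheory GRing.Theory Num.Theory.
Import numFieldNormedType.Exports.

Local Open Scope classical_set_scope.
Local Open Scope ring_scope.

(* A point (x_0, x_1, x_2) is a row vector [x] with [x_k = x 0 k]; in ['I_3]
   the ring literals 0, 1, 2 are the three indices. *)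

(* The norm [`|x|] of ['rV[R]_3] is the maximum norm. *)
Lemma rV3_normE (R : realType) (x : 'rV[R]_3) :
  `|x| = Num.max `|x 0 0| (Num.max `|x 0 1| `|x 0 2|).
Proof.
rewrite [X in X = _]mx_normrE; apply/eqP; rewrite eq_le; apply/andP; split.
  apply: bigmax_le => [|[i j] _ /=]; first by rewrite le_max normr_ge0.
  rewrite (ord1 i) !le_max.
  case: j => [[|[|[|//]]] lt_j];
    [rewrite (_ : Ordinal lt_j = 0) | rewrite (_ : Ordinal lt_j = 1)
    | rewrite (_ : Ordinal lt_j = 2)]; try exact: val_inj;
    by rewrite lexx ?orbT.
rewrite !ge_max; apply/and3P; split;
  exact: (@le_bigmax _ _ _ _ (fun ij => `|x ij.1 ij.2|) (0, _)).
Qed.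

Definition lin_indep_Q (R : realType) (u v w : R) : Prop :=
  forall a b c : rat, ratr a * u + ratr b * v + ratr c * w = 0 ->
    [/\ a = 0, b = 0 & c = 0].

Definition Lform (R : realType) (xi : R) (x : 'rV[R]_3) : R :=
  Num.max `|x 0 1 - x 0 0 * xi| `|x 0 2 - x 0 0 * xi ^+ 3|.

Definition real_point (R : realType) (x : 'rV[int]_3) : 'rV[R]_3 :=
  map_mx intr x.

(* The sequence is indexed from 1: the value [x 0] is unconstrained. *)
Definition minimal_points (R : realType) (xi : R) (x : nat -> 'rV[int]_3) :
    Prop :=
  let X (i : nat) := `|real_point R (x i)| in
  let L (i : nat) := Lform xi (real_point R (x i)) in
  [/\ forall i, (1 <= i)%N -> x i != 0,
      forall i, (1 <= i)%N -> X i < X i.+1,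
      L 1%N < 2^-1,
      forall i, (1 <= i)%N -> L i.+1 < L i
    & forall (y : 'rV[int]_3) (i : nat), y != 0 -> (1 <= i)%N ->
        Lform xi (real_point R y) < L i -> X i.+1 <= `|real_point R y| ].

Definition indepI (R : realType) (x : nat -> 'rV[int]_3) : set nat :=
  [set i | (2 <= i)%N /\
    free [:: real_point R (x i.-1); real_point R (x i); real_point R (x i.+1)]].

(* The least element of [S] greater than [i]; 0 if there is none. *)
Definition succ_in (S : set nat) (i : nat) : nat :=
  xget 0%N [set j | [/\ S j, (i < j)%N &
    forall k, S k -> (i < k)%N -> (j <= k)%N]].

Section Forms.
Context {A : comNzRingType}.
Implicit Types x y z : 'rV[A]_3.

Definition phi x : A := x 0 0 ^+ 2 * x 0 2 - x 0 1 ^+ 3.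

Definition Phi x y z : A :=
  x 0 0 * y 0 0 * z 0 2 + x 0 0 * y 0 2 * z 0 0 + x 0 2 * y 0 0 * z 0 0
  - 3 * x 0 1 * y 0 1 * z 0 1.

Definition Fform x y : A := Phi x x y ^+ 2 - 4 * phi x * Phi x y y.

End Forms.

Definition Fseq (R : realType) (x : nat -> 'rV[int]_3) (i : nat) : int :=
  Fform (x i) (x (succ_in (indepI R x) i)).

(* Main.v *)
Require Import Defs.
From HB Require Import structures.
From mathcomp Require Import all_boot all_order all_algebra.
From mathcomp Require Import all_classical all_reals all_analysis.
From mathcomp Require Import ring lra.

Set Implicit Arguments.
Unset Strict Implicit.
Unset Printing Implicit Defensive.

Import Order.TTheory GRing.Theory Num.Theory.
Import numFieldNormedType.Exports.

Local Open Scope classical_set_scope.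
Local Open Scope ring_scope.

(** Let [i < j] be consecutive in [I]; write [x = x_i], [w = x_{i+1}],
    [y = x_j], let [X], [W], [Y] be their norms, [L = L(x)], [M = L(y)], and
    let [<<] hide constants that depend only on [xi] and [c].  Suppose that
    [F(x, y) = 0].  Two consequences of this contradict each other when [X]
    is large.

    Arithmetic.  The points [x_i, ..., x_j] lie in one plane, whose integer
    points are generated by [x] and [w] ([mp_lattice], [mp_span]).  So
    [y = q x + p w], where [p] and [q] are coprime because minimal points are
    primitive, and [Y << |p| W] by comparison of minors ([mp_index_ge]).  In
    this basis [Phi(x,x,y)^2] is a multiple of [p^2] minus [3 F(x,y)]; hence
    [p] divides [Phi(x,x,y) = 3 q phi(x) + p Phi(x,x,w)], and so it divides
    both [3 phi(x)] and [3 phi(y)] ([dvdz_3phi]).  As [phi(x)] and [phi(y)]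
    are non-zero ([mp_phi_neq0]), [|p| << |phi(x)| << X^2 L] and
    [|p| << |phi(y)|].  In particular [Y << W X^2 L].

    Geometry.  When [F(x,y) = 0], the part of degree at most 2 in [t] of
    [phi(x + t y)] is a constant times the square of a linear form.  At the
    [t] for which [x + t y] has first coordinate 0, this gives the exact
    relation [phi_mul_phi] between [phi(x) phi(y)], the distance from that [t]
    to the double root, and a small cube.  Both of the latter are controlled
    by [L] and [M], and with [p^2 << |phi(x) phi(y)|] one gets
    [p^2 X << Y X^4 M^2 + Y^3 L^4] ([root_bound]).

    Sizes.  Rounding the exponent down to 9/13, [L_k << X_{k+1}^(-9/13)] for
    every large [k] ([mp_rate]).  For [k] in [I] the determinant of
    [x_{k-1}, x_k, x_{k+1}] is a non-zero integer, whence
    [X_k^9 << X_{k+1}^4] ([mp_indep_det], [gap_of_rate]).  This makes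
    [Y X^4 M^2] much smaller than [X], so that [Y^2 X << W^2 p^2 X] is
    [<< W^2 Y^3 L^4], that is [X << W^2 Y L^4].  With [Y << W X^2 L] this
    becomes [1 << W^3 X L^5]; but [L^13 << W^(-9)] and [X^9 << W^4] bound the
    right side by a negative power of [X]. *)

(** * Polynomial identities and divisibility *)

Section PolarForms.
Context {A : comNzRingType}.
Implicit Types (x y w : 'rV[A]_3) (p q : A).

Lemma Phi_comb x w p q :
  Phi x x (q *: x + p *: w) = 3 * phi x * q + p * Phi x x w.
Proof. by rewrite /Phi /phi !mxE; ring. Qed.

Lemma phi_comb x w p q :
  phi (q *: x + p *: w) = q ^+ 3 * phi x
    + p * (q ^+ 2 * Phi x x w + q * p * Phi x w w + p ^+ 2 * phi w).
Proof. by rewrite /Phi /phi !mxE; ring. Qed.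

(** In the pencil of [x] and [w] the form [F] is quadratic in [(q, p)]; minus
    three times it is the square of the linear form [Phi x x y] up to a multiple
    of [p ^+ 2].  Hence [F = 0] forces [p] to divide [Phi x x y]. *)
Lemma sqr_Phi_comb x w p q (y := q *: x + p *: w) :
  Phi x x y ^+ 2 = p ^+ 2 * (4 * Phi x x w ^+ 2 - 12 * phi x * Phi x w w)
    - 3 * Fform x y.
Proof. by rewrite /y /Fform /Phi /phi !mxE; ring. Qed.

(** [y_0 x - x_0 y] has first coordinate 0, so [phi] of it is minus the cube of
    its second coordinate.  Expanding [phi] along the pencil and completing the
    square in its part of degree at most 2 in [y] leaves the discriminant
    [Fform x y] as the only obstruction. *)
Lemma phi_mul_phi x y :
  4 * phi x * phi y * x 0 0 ^+ 3 =
    y 0 0 * (2 * phi x * y 0 0 - Phi x x y * x 0 0) ^+ 2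
    + 4 * phi x * (y 0 0 * x 0 1 - x 0 0 * y 0 1) ^+ 3
    - x 0 0 ^+ 2 * y 0 0 * Fform x y.
Proof. by rewrite /Fform /Phi /phi; ring. Qed.

End PolarForms.

(** By [sqr_Phi_comb], [p] divides [Phi x x y], that is
    [3 q phi x + p Phi x x w], and [q] is invertible modulo [p]; then [phi y]
    is congruent to [q^3 phi x] modulo [p]. *)
Lemma dvdz_3phi (x w : 'rV[int]_3) (p q : int) (y := q *: x + p *: w) :
  coprimez p q -> Fform x y = 0 ->
  (p %| 3 * phi x)%Z /\ (p %| 3 * phi y)%Z.
Proof.
move=> copq F0.
have pb : (p %| Phi x x y)%Z.
  rewrite -(@dvdz_pexp2r _ _ 2) // (sqr_Phi_comb x w) -/y F0 mulr0 subr0.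
  exact: dvdz_mulr.
have pa : (p %| 3 * phi x)%Z.
  rewrite -(@Gauss_dvdzl _ _ q) //.
  by move: pb; rewrite Phi_comb rpredDr // dvdz_mulr.
split=> //; rewrite phi_comb mulrDr rpredD //.
  by rewrite mulrCA dvdz_mull.
by rewrite mulrCA dvdz_mulr.
Qed.

(** * Integer points on the cuspidal cubic *)

Lemma ler_absz_dvd (d n : int) : n != 0 -> (d %| n)%Z -> `|d| <= `|n|.
Proof.
by move=> n0 /dvdzP[k En]; move: n0; rewrite {}En mulf_eq0 normrM;
  move=> /norP[k0 _]; rewrite ler_peMl // -gtz0_ge1 normr_gt0.
Qed.

(** The rational points of the cubic [x_0^2 x_2 = x_1^3] other than its cusp are
    [(1 : r : r^3)]; here [r = q / p].  Coprimality makes [p ^+ 2] divide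
    [gcd(x_0, x_1)], which clears the denominators. *)
Lemma cusp_param (x : 'rV[int]_3) : phi x = 0 -> x 0 0 != 0 ->
  exists p q e : int, [/\ coprimez p q, x 0 0 = p ^+ 3 * e,
    x 0 1 = p ^+ 2 * q * e & x 0 2 = q ^+ 3 * e].
Proof.
move=> phi0 x0.
have d0 : gcdz (x 0 0) (x 0 1) != 0 by rewrite gcdz_eq0 negb_and x0.
have /dvdzP[p Ep] := dvdz_gcdl (x 0 0) (x 0 1).
have /dvdzP[q Eq] := dvdz_gcdr (x 0 0) (x 0 1).
set d := gcdz _ _ in d0 Ep Eq.
have p0 : p != 0 by apply: contra_neq x0 => p0; rewrite Ep p0 mul0r.
have copq : coprimez p q.
  apply/coprimezP; have [u [v Euv]] := Bezoutz (x 0 0) (x 0 1).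
  exists (u, v); apply: (mulIf d0) => /=.
  by rewrite mul1r -[RHS]Euv {1}Ep {1}Eq; ring.
have E : p ^+ 2 * x 0 2 = q ^+ 3 * d.
  apply: (mulfI (expf_neq0 2 d0)).
  move/eqP: phi0; rewrite subr_eq0 Ep Eq => /eqP E.
  by transitivity ((p * d) ^+ 2 * x 0 2); [ring | rewrite E; ring].
have /dvdzP[e Ee] : (p ^+ 2 %| d)%Z.
  rewrite -(@Gauss_dvdzr _ (q ^+ 3)) ?coprimezXl ?coprimezXr //.
  by rewrite -E dvdz_mulr.
exists p, q, e; split=> //; first by rewrite Ep Ee; ring.
  by rewrite Eq Ee; ring.
by apply: (mulfI (expf_neq0 2 p0)); rewrite E Ee; ring.
Qed.

(** An integer point on the cubic is far from every other rational point: its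
    minors with [w] are divisible by [p^2 e], or by [p e] when the first one
    vanishes, and [|p e|^3 >= |p^3 e| = |x_0|].  This repels a nearby
    minimal point, which is why [phi] cannot vanish at minimal points. *)
Lemma cusp_gap (x w : 'rV[int]_3)
    (m := x 0 0 * w 0 1 - x 0 1 * w 0 0) (n := x 0 0 * w 0 2 - x 0 2 * w 0 0) :
    phi x = 0 -> x 0 0 != 0 -> (m != 0) || (n != 0) ->
  `|x 0 0| <= Num.max `|m| `|n| ^+ 3.
Proof.
move=> phi0 x0; have [p [q [e [copq E0 E1 E2]]]] := cusp_param phi0 x0.
have e0 : e != 0 by apply: contra_neq x0 => e0; rewrite E0 e0 mulr0.
have p0 : p != 0 by apply: contra_neq x0 => p0; rewrite E0 p0 expr0n mul0r.
have p1 : 1 <= `|p| by rewrite -gtz0_ge1 normr_gt0.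
have e1 : 1 <= `|e| by rewrite -gtz0_ge1 normr_gt0.
have Nx : `|x 0 0| = `|p| ^+ 3 * `|e| by rewrite E0 normrM normrX.
have big k : `|p * e| <= k -> `|x 0 0| <= k ^+ 3.
  rewrite normrM => le_k; rewrite Nx.
  have : (`|p| * `|e|) ^+ 3 <= k ^+ 3.
    by rewrite lerXn2r ?nnegrE // ?mulr_ge0 ?(le_trans _ le_k) ?mulr_ge0.
  apply: le_trans; rewrite exprMn ler_wpM2l ?exprn_ge0 //.
  by rewrite ler_eXnr.
have Em : m = p ^+ 2 * e * (p * w 0 1 - q * w 0 0) by rewrite /m E0 E1; ring.
have [m0 /= n0|m0 _] := eqVneq m 0.
  have /eqP := m0.
  rewrite Em mulf_eq0 mulf_eq0 expf_eq0 (negPf p0) (negPf e0) /=.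
  rewrite subr_eq0 => /eqP pw.
  have /dvdzP[k Ek] : (p %| (w 0 0)%R)%Z.
    by rewrite -(@Gauss_dvdzr _ q) // -pw dvdz_mulr.
  apply/big; rewrite le_max; apply/orP; right; apply: ler_absz_dvd => //.
  have -> : n = (p ^+ 2 * w 0 2 - q ^+ 3 * k) * (p * e).
    by rewrite /n E0 E2 Ek; ring.
  exact: dvdz_mull.
apply/big; rewrite le_max; apply/orP; left; apply: ler_absz_dvd => //.
have -> : m = p * (p * w 0 1 - q * w 0 0) * (p * e) by rewrite Em; ring.
exact: dvdz_mull.
Qed.

(** * Estimates for a single point or a pair of points *)

Ltac norm_bound :=
  rewrite ?(normrM, normrX, normrN, normr_nat);
  repeat (first [done | assumption | apply: ler_pM | apply: lerXn2r
                | apply: mulr_ge0 | apply: exprn_ge0 | apply: normr_ge0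
                | rewrite nnegrE]).

Section Estimates.
Context {R : realType}.
Variable xi : R.
Let B : R := 1 + `|xi|.
Local Notation L := (Lform xi).
Implicit Types x y z : 'rV[R]_3.

Let B1 : 1 <= B. Proof. by rewrite /B lerDl. Qed.
Let B0 : 0 <= B. Proof. exact: le_trans B1. Qed.
Let xiB : `|xi| <= B. Proof. by rewrite /B lerDr. Qed.
Let xi3B : `|xi ^+ 3| <= B ^+ 3.
Proof. by norm_bound. Qed.

Lemma norm_coord_le x (k : 'I_3) : `|x 0 k| <= `|x|.
Proof.
rewrite [leRHS]mx_normrE.
exact: (@le_bigmax _ _ _ _ (fun ij => `|x ij.1 ij.2|) (0, k)).
Qed.

Lemma Lform_ge x :
  `|x 0 1 - x 0 0 * xi| <= L x /\ `|x 0 2 - x 0 0 * xi ^+ 3| <= L x.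
Proof. by rewrite /Lform !le_max !lexx orbT. Qed.

Lemma Lform_ge0 x : 0 <= L x.
Proof. by rewrite /Lform le_max normr_ge0. Qed.

Lemma Lform_comb x y (a b : R) : L (a *: x + b *: y) <= `|a| * L x + `|b| * L y.
Proof.
have [x1 x2] := Lform_ge x; have [y1 y2] := Lform_ge y.
rewrite {1}/Lform ge_max !mxE; apply/andP; split.
  rewrite (_ : _ - _ = a * (x 0 1 - x 0 0 * xi) + b * (y 0 1 - y 0 0 * xi));
    last by ring.
  by apply: (le_trans (ler_normD _ _)); rewrite !normrM lerD // ler_wpM2l.
rewrite (_ : _ - _ = a * (x 0 2 - x 0 0 * xi ^+ 3)
                   + b * (y 0 2 - y 0 0 * xi ^+ 3)); last by ring.
by apply: (le_trans (ler_normD _ _)); rewrite !normrM lerD // ler_wpM2l.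
Qed.

Lemma LformZ x (a : R) : L (a *: x) <= `|a| * L x.
Proof.
by have := Lform_comb x x a 0; rewrite scale0r addr0 normr0 mul0r addr0.
Qed.

(** [x] is [x 0 0 *: (1, xi, xi ^+ 3)] up to an error [L x], so its norm is
    carried by its first coordinate. *)
Lemma norm_le_coord0 x : 1 <= `|x| -> L x <= 2^-1 ->
  `|x| <= 2 * B ^+ 3 * `|x 0 0|.
Proof.
move=> x1 L2; have [d1 d2] := Lform_ge x.
have B3 : B <= B ^+ 3 by apply: ler_eXnr.
have B31 : 1 <= B ^+ 3 by apply: le_trans B3.
have u0 := normr_ge0 (x 0 0).
suff : `|x| <= B ^+ 3 * `|x 0 0| + 2^-1 by move: x1; lra.
have m1 : `|x 0 0 * xi| <= B ^+ 3 * `|x 0 0|.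
  by rewrite normrM mulrC ler_wpM2r // (le_trans xiB).
have m2 : `|x 0 0 * xi ^+ 3| <= B ^+ 3 * `|x 0 0|.
  by rewrite normrM mulrC ler_wpM2r.
rewrite {1}rV3_normE !ge_max; apply/and3P; split.
- have := ler_wpM2r u0 B31; rewrite mul1r; lra.
- rewrite -[x 0 1](subrK (x 0 0 * xi)) (le_trans (ler_normD _ _)) //.
  by rewrite addrC lerD // (le_trans d1).
- rewrite -[x 0 2](subrK (x 0 0 * xi ^+ 3)) (le_trans (ler_normD _ _)) //.
  by rewrite addrC lerD // (le_trans d2).
Qed.

Lemma minor_le x y (k : 'I_3) : k = 1 \/ k = 2 ->
  `|x 0 0 * y 0 k - x 0 k * y 0 0| <= `|x| * L y + `|y| * L x.
Proof.
have [d1 d2] := Lform_ge x; have [e1 e2] := Lform_ge y.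
have u := norm_coord_le x 0; have v := norm_coord_le y 0.
case=> ->.
  rewrite (_ : _ - _ = x 0 0 * (y 0 1 - y 0 0 * xi)
                     - y 0 0 * (x 0 1 - x 0 0 * xi)); last by ring.
  by apply: (le_trans (ler_normB _ _)); rewrite lerD //; norm_bound.
rewrite (_ : _ - _ = x 0 0 * (y 0 2 - y 0 0 * xi ^+ 3)
                   - y 0 0 * (x 0 2 - x 0 0 * xi ^+ 3)); last by ring.
by apply: (le_trans (ler_normB _ _)); rewrite lerD //; norm_bound.
Qed.

Lemma minor_ge x y :
  `|y 0 0| * L x <= `|x| * L y
    + Num.max `|x 0 0 * y 0 1 - x 0 1 * y 0 0| `|x 0 0 * y 0 2 - x 0 2 * y 0 0|.
Proof.
have [e1 e2] := Lform_ge y.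
have u := norm_coord_le x 0.
rewrite {1}/Lform; case: (leP `|x 0 1 - _| `|x 0 2 - _|) => _.
  rewrite -normrM; have -> : y 0 0 * (x 0 2 - x 0 0 * xi ^+ 3) =
      x 0 0 * (y 0 2 - y 0 0 * xi ^+ 3)
      - (x 0 0 * y 0 2 - x 0 2 * y 0 0) by ring.
  apply: (le_trans (ler_normB _ _)); rewrite lerD ?le_max ?lexx ?orbT //.
  by norm_bound.
rewrite -normrM; have -> : y 0 0 * (x 0 1 - x 0 0 * xi) =
    x 0 0 * (y 0 1 - y 0 0 * xi)
    - (x 0 0 * y 0 1 - x 0 1 * y 0 0) by ring.
apply: (le_trans (ler_normB _ _)); rewrite lerD ?le_max ?lexx //.
by norm_bound.
Qed.

(** Put [x_1 = x_0 xi + d] and [x_2 = x_0 xi^3 + e]: since [phi] vanishes at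
    [(1, xi, xi^3)], the leading term of [phi x] is [x_0^2 (e - 3 xi^2 d)]. *)
Lemma phi_le x : L x <= `|x| -> `|phi x| <= 8 * B ^+ 2 * `|x| ^+ 2 * L x.
Proof.
move=> LX; have [d1 d2] := Lform_ge x.
have u := norm_coord_le x 0; have L0 := Lform_ge0 x.
set d := x 0 1 - _ in d1; set e := x 0 2 - _ in d2; set X := `|x| in LX u *.
have -> : phi x = x 0 0 ^+ 2 * e - 3 * (xi ^+ 2 * x 0 0 ^+ 2 * d)
    - 3 * (xi * x 0 0 * d * d) - d ^+ 2 * d by rewrite /phi /e /d; ring.
apply: (le_trans (ler_normB _ _)).
have X0 : 0 <= X by exact: normr_ge0.
have t1 : `|x 0 0 ^+ 2 * e| <= B ^+ 2 * X ^+ 2 * L x.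
  rewrite -[`|_|]mul1r -mulrA; apply: ler_pM => //; last by norm_bound.
  by apply: exprn_ege1.
have t2 : `|xi ^+ 2 * x 0 0 ^+ 2 * d| <= B ^+ 2 * X ^+ 2 * L x by norm_bound.
have t3 : `|xi * x 0 0 * d * d| <= B ^+ 2 * X ^+ 2 * L x.
  apply: (@le_trans _ _ (B * X * X * L x)).
    by norm_bound; apply: le_trans LX.
  rewrite -(mulrA B) -expr2 !(ler_wpM2r, exprn_ge0) //.
  by rewrite ler_eXnr.
have t4 : `|d ^+ 2 * d| <= B ^+ 2 * X ^+ 2 * L x.
  rewrite -[`|_|]mul1r -mulrA; apply: ler_pM => //; last first.
    by norm_bound; apply: le_trans LX.
  by apply: exprn_ege1.
have := ler_normB (x 0 0 ^+ 2 * e - 3 * (xi ^+ 2 * x 0 0 ^+ 2 * d))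
  (3 * (xi * x 0 0 * d * d)).
have := ler_normB (x 0 0 ^+ 2 * e) (3 * (xi ^+ 2 * x 0 0 ^+ 2 * d)).
rewrite !(normrM 3) (normr_nat _ 3); lra.
Qed.

(** The left side measures how far [- x_0 / y_0] is from the zero
    [- 2 phi x / Phi x x y] of the square that [F(x,y) = 0] produces.  The two
    products are each of order [X^2 Y L], but their leading parts
    [2 x_0^2 y_0 (e - 3 xi^2 d)] cancel, where [d] and [e] are the errors of [x]
    as above. *)
Lemma double_root_le x y : L y <= L x -> L x <= `|x| -> `|x| <= `|y| ->
  `|2 * phi x * y 0 0 - Phi x x y * x 0 0|
    <= 15 * B ^+ 2 * (`|x| ^+ 3 * L y + `|x| * `|y| * L x ^+ 2).
Proof.
move=> LL LX XY; have [d1 _] := Lform_ge x; have [e1 e2] := Lform_ge y.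
have u := norm_coord_le x 0; have v := norm_coord_le y 0.
have L0 := Lform_ge0 x; have L0' := Lform_ge0 y.
set d := x 0 1 - _ in d1; set e := y 0 1 - _ in e1; set f := y 0 2 - _ in e2.
set X := `|x| in LX XY u *; set Y := `|y| in XY v *.
have -> : 2 * phi x * y 0 0 - Phi x x y * x 0 0 =
  3 * (xi ^+ 2 * x 0 0 ^+ 3 * e) - x 0 0 ^+ 3 * f
  - 3 * (xi * (x 0 0 * y 0 0 * d ^+ 2)) + 6 * (xi * (x 0 0 ^+ 2 * d * e))
  - 2 * (y 0 0 * d * d ^+ 2) + 3 * (x 0 0 * e * d ^+ 2).
  by rewrite /phi /Phi /e /d /f; ring.
have X0 : 0 <= X by exact: normr_ge0.
have Y0 : 0 <= Y by exact: normr_ge0.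
have B2 : 1 <= B ^+ 2 by apply: exprn_ege1.
have BB : B <= B ^+ 2 by apply: ler_eXnr.
set P := B ^+ 2 * (X ^+ 3 * L y); set Q := B ^+ 2 * (X * Y * L x ^+ 2).
have t1 : `|xi ^+ 2 * x 0 0 ^+ 3 * e| <= P.
  by rewrite /P [leRHS]mulrA; norm_bound.
have t2 : `|x 0 0 ^+ 3 * f| <= P.
  by rewrite -[`|_|]mul1r; apply: ler_pM => //; norm_bound.
have t3 : `|xi * (x 0 0 * y 0 0 * d ^+ 2)| <= Q.
  by rewrite normrM; apply: ler_pM => //; [exact: le_trans BB | norm_bound].
have t4 : `|xi * (x 0 0 ^+ 2 * d * e)| <= Q.
  rewrite normrM; apply: ler_pM => //; first exact: le_trans BB.
  rewrite (_ : x 0 0 ^+ 2 * d * e = x 0 0 * x 0 0 * (d * e)); last by ring.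
  rewrite expr2; norm_bound; [exact: le_trans XY | exact: le_trans LL].
have t5 : `|y 0 0 * d * d ^+ 2| <= Q.
  rewrite -[`|_|]mul1r; apply: ler_pM => //.
  by rewrite (mulrC X); norm_bound; exact: le_trans LX.
have t6 : `|x 0 0 * e * d ^+ 2| <= Q.
  rewrite -[`|_|]mul1r; apply: ler_pM => //.
  by norm_bound; apply: (le_trans e1); apply: (le_trans LL); apply: le_trans XY.
rewrite (_ : 15 * B ^+ 2 * _ = 15 * P + 15 * Q); last by rewrite /P /Q; ring.
apply: (le_trans (ler_normD _ _)).
set T1 := xi ^+ 2 * _ * e in t1 *; set T2 := _ * f in t2 *.
set T3 := xi * (_ * d ^+ 2) in t3 *; set T4 := xi * (_ * e) in t4 *.
set T5 := _ * d * _ in t5 *; set T6 := _ * d ^+ 2 in t6 *.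
have := ler_normB (3 * T1 - T2 - 3 * T3 + 6 * T4) (2 * T5).
have := ler_normD (3 * T1 - T2 - 3 * T3) (6 * T4).
have := ler_normB (3 * T1 - T2) (3 * T3).
have := ler_normB (3 * T1) T2.
have P0 : 0 <= P by apply: le_trans t1.
have Q0 : 0 <= Q by apply: le_trans t3.
rewrite !(normrM 3) (normrM 6) (normrM 2) !normr_nat; lra.
Qed.

End Estimates.

(** * Linear dependence of three points *)

Lemma row3_eq (T : Type) (x y : 'rV[T]_3) :
  x 0 0 = y 0 0 -> x 0 1 = y 0 1 -> x 0 2 = y 0 2 -> x = y.
Proof.
move=> e0 e1 e2; apply/rowP => -[[|[|[|//]]] k3].
- by rewrite (_ : Ordinal k3 = 0) //; apply: val_inj.
- by rewrite (_ : Ordinal k3 = 1) //; apply: val_inj.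
- by rewrite (_ : Ordinal k3 = 2) //; apply: val_inj.
Qed.

Lemma notfree3P (K : fieldType) (V : vectType K) (u v w : V) :
  free [:: u; v] ->
  reflect (exists a b, w = a *: u + b *: v) (~~ free [:: u; v; w]).
Proof.
move=> fuv.
rewrite (perm_free (_ : perm_eq [:: u; v; w] [:: w; u; v])); last first.
  by have := perm_rot 2 [:: u; v; w] [:: u; v; w]; rewrite perm_refl perm_sym.
rewrite free_cons fuv andbT negbK span_cons span_seq1.
apply: (iffP memv_addP) => [[_ /vlineP[a ->] [_ /vlineP[b ->]] ->]|[a [b ->]]].
  by exists a, b.
exists (a *: u); first by apply/vlineP; exists a.
by exists (b *: v) => //; apply/vlineP; exists b.
Qed.

Definition det3 (A : comPzRingType) (u v w : 'rV[A]_3) : A :=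
  u 0 0 * (v 0 1 * w 0 2 - v 0 2 * w 0 1)
  - u 0 1 * (v 0 0 * w 0 2 - v 0 2 * w 0 0)
  + u 0 2 * (v 0 0 * w 0 1 - v 0 1 * w 0 0).

Lemma det3_eq0_comb (K : fieldType) (u v w : 'rV[K]_3) :
  (u 0 0 * v 0 1 - u 0 1 * v 0 0 != 0)
    || (u 0 0 * v 0 2 - u 0 2 * v 0 0 != 0) ->
  det3 u v w = 0 -> exists a b, w = a *: u + b *: v.
Proof.
rewrite /det3 => /orP[m0|m0] D0.
  exists ((w 0 0 * v 0 1 - w 0 1 * v 0 0) / (u 0 0 * v 0 1 - u 0 1 * v 0 0)).
  exists ((u 0 0 * w 0 1 - u 0 1 * w 0 0) / (u 0 0 * v 0 1 - u 0 1 * v 0 0)).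
  apply: row3_eq; rewrite !mxE; try by field.
  apply: (mulfI m0); rewrite -[LHS]subr0 -D0; field.
  exact: m0.
exists ((w 0 0 * v 0 2 - w 0 2 * v 0 0) / (u 0 0 * v 0 2 - u 0 2 * v 0 0)).
exists ((u 0 0 * w 0 2 - u 0 2 * w 0 0) / (u 0 0 * v 0 2 - u 0 2 * v 0 0)).
apply: row3_eq; rewrite !mxE; try by field.
apply: (mulfI m0); rewrite -[LHS]addr0 -D0; field.
exact: m0.
Qed.

Lemma det3_real (R : realType) (u v w : 'rV[int]_3) :
  det3 (real_point R u) (real_point R v) (real_point R w) = (det3 u v w)%:~R.
Proof. by rewrite /det3 !mxE !(rmorphB, rmorphD, rmorphM, rmorph_nat). Qed.

Lemma phi_real (R : realType) (u : 'rV[int]_3) :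
  phi (real_point R u) = (phi u)%:~R.
Proof. by rewrite /phi !mxE rmorphB rmorphM !rmorphXn. Qed.

Lemma Phi_real (R : realType) (u v w : 'rV[int]_3) :
  Phi (real_point R u) (real_point R v) (real_point R w) = (Phi u v w)%:~R.
Proof. by rewrite /Phi !mxE !(rmorphB, rmorphD, rmorphM, rmorph_nat). Qed.

Lemma real_point_comb (R : realType) (u v : 'rV[int]_3) (a b : int) :
  real_point R (a *: u + b *: v)
  = a%:~R *: real_point R u + b%:~R *: real_point R v.
Proof. by apply/rowP=> k; rewrite !mxE rmorphD !rmorphM. Qed.

Lemma real_point_eq0 (R : realType) (u : 'rV[int]_3) :
  (real_point R u == 0) = (u == 0).
Proof.
apply/eqP/eqP => [/rowP E|->]; last by apply/rowP=> k; rewrite !mxE.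
by apply/rowP => k; have := E k; rewrite !mxE => /eqP; rewrite intr_eq0 => /eqP.
Qed.

Lemma norm_real_point_nat (R : realType) (u : 'rV[int]_3) :
  exists n : nat, `|real_point R u| = n%:R.
Proof.
have N (z : int) : `|z%:~R| = `|z|%N%:R :> R.
  by rewrite -intr_norm -abszE pmulrn.
rewrite rV3_normE !mxE !N -!natr_max; by eexists.
Qed.

(** Subtracting multiples of the first column replaces the other two by the
    errors of size [L]. *)
Lemma det3_le (R : realType) (xi : R) (u v w : 'rV[R]_3) (L := Lform xi) :
  L v <= L u -> L w <= L v -> `|u| <= `|v| -> `|v| <= `|w| ->
  `|det3 u v w| <= 6 * (`|w| * L v * L u).
Proof.
move=> L1 L2 X1 X2.
have [u1 u2] := Lform_ge xi u; have [v1 v2] := Lform_ge xi v.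
have [w1 w2] := Lform_ge xi w.
have u0 := norm_coord_le u 0; have v0 := norm_coord_le v 0.
have w0 := norm_coord_le w 0.
have Lu := Lform_ge0 xi u; have Lv := Lform_ge0 xi v; have Lw := Lform_ge0 xi w.
rewrite -!/L in u1 u2 v1 v2 w1 w2 Lu Lv Lw.
set a1 := u 0 1 - _ in u1; set a2 := u 0 2 - _ in u2.
set b1 := v 0 1 - _ in v1; set b2 := v 0 2 - _ in v2.
set c1 := w 0 1 - _ in w1; set c2 := w 0 2 - _ in w2.
have -> : det3 u v w = u 0 0 * b1 * c2 - u 0 0 * b2 * c1
  - v 0 0 * a1 * c2 + v 0 0 * a2 * c1 + w 0 0 * b2 * a1 - w 0 0 * b1 * a2.
  by rewrite /det3 /a1 /a2 /b1 /b2 /c1 /c2; ring.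
set P := `|w| * L v * L u.
have X3 : `|u| <= `|w| by apply: le_trans X2.
have L3 : L w <= L u by apply: le_trans L1.
have bnd x y z (X Y Z : R) : `|x| <= X -> `|y| <= Y -> `|z| <= Z ->
   X <= `|w| -> Y <= L v -> Z <= L u -> `|x * y * z| <= P.
  move=> *; rewrite /P; norm_bound; (apply: le_trans; [|eassumption]); by [].
have bnd' x y z (X Y Z : R) : `|x| <= X -> `|y| <= Y -> `|z| <= Z ->
   X <= `|w| -> Y <= L u -> Z <= L v -> `|x * y * z| <= P.
  by move=> *; rewrite mulrAC; apply: (bnd _ _ _ X Z Y).
have t1 := bnd _ _ _ _ _ _ u0 v1 w2 X3 (lexx _) L3.
have t2 := bnd _ _ _ _ _ _ u0 v2 w1 X3 (lexx _) L3.
have t3 := bnd' _ _ _ _ _ _ v0 u1 w2 X2 (lexx _) L2.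
have t4 := bnd' _ _ _ _ _ _ v0 u2 w1 X2 (lexx _) L2.
have t5 := bnd _ _ _ _ _ _ w0 v2 u1 (lexx _) (lexx _) (lexx _).
have t6 := bnd _ _ _ _ _ _ w0 v1 u2 (lexx _) (lexx _) (lexx _).
move: t1 t2 t3 t4 t5 t6.
set T1 := _ * c2; set T2 := _ * c1; set T3 := _ * c2; set T4 := _ * c1.
set T5 := _ * a1; set T6 := _ * a2.
have := ler_normB (T1 - T2 - T3 + T4 + T5) T6.
have := ler_normD (T1 - T2 - T3 + T4) T5.
have := ler_normD (T1 - T2 - T3) T4.
have := ler_normB (T1 - T2) T3.
have := ler_normB T1 T2.
lra.
Qed.

(** * The lattice structure of minimal points *)

Section MinimalPoints.
Context {R : realType}.
Variables (xi : R) (x : nat -> 'rV[int]_3).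
Hypothesis hx : minimal_points xi x.

Local Notation pt i := (real_point R (x i)).
Local Notation X i := (`|pt i|).
Local Notation L i := (Lform xi (pt i)).

Lemma mp_neq0 i : (1 <= i)%N -> x i != 0.
Proof. by case: hx => h _ _ _ _; apply: h. Qed.

Lemma mp_normS i : (1 <= i)%N -> X i < X i.+1.
Proof. by case: hx => _ h _ _ _; apply: h. Qed.

Lemma mp_LformS i : (1 <= i)%N -> L i.+1 < L i.
Proof. by case: hx => _ _ _ h _; apply: h. Qed.

Lemma mp_min i (y : 'rV[int]_3) : (1 <= i)%N -> y != 0 ->
  `|real_point R y| < X i.+1 -> L i <= Lform xi (real_point R y).
Proof.
case: hx => _ _ _ _ h i1 y0 yX; rewrite leNgt; apply/negP => yL.
by have := h y i y0 i1 yL; rewrite leNgt yX.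
Qed.

Lemma mp_norm_lt i j : (1 <= i)%N -> (i < j)%N -> X i < X j.
Proof.
move=> i1; elim: j => // j IH; rewrite ltnS leq_eqVlt => /orP[/eqP<-|ij].
  exact: mp_normS.
by apply: lt_trans (IH ij) (mp_normS _); apply: leq_trans ij.
Qed.

Lemma mp_Lform_lt i j : (1 <= i)%N -> (i < j)%N -> L j < L i.
Proof.
move=> i1; elim: j => // j IH; rewrite ltnS leq_eqVlt => /orP[/eqP<-|ij].
  exact: mp_LformS.
by apply: lt_trans (mp_LformS _) (IH ij); apply: leq_trans ij.
Qed.

Lemma mp_norm_ge i : (1 <= i)%N -> i%:R <= X i.
Proof.
elim: i => // -[_ _|i IH _].
  have [n En] := norm_real_point_nat R (x 1%N).
  rewrite En ler_nat lt0n -(@pnatr_eq0 R) -En normr_eq0 real_point_eq0.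
  exact: mp_neq0.
have := le_lt_trans (IH isT) (mp_normS (isT : (1 <= i.+1)%N)).
by have [n ->] := norm_real_point_nat R (x i.+2); rewrite ltr_nat ler_nat.
Qed.

Lemma mp_norm_ge1 i : (1 <= i)%N -> 1 <= X i.
Proof. by move=> i1; apply: le_trans (mp_norm_ge i1); rewrite ler1n. Qed.

Lemma mp_Lform_gt0 i : (1 <= i)%N -> 0 < L i.
Proof. by move=> i1; apply: le_lt_trans (mp_LformS i1); apply: Lform_ge0. Qed.

Lemma mp_Lform_le_half i : (1 <= i)%N -> L i <= 2^-1.
Proof.
have L1 : L 1%N <= 2^-1 by case: hx => _ _ /ltW.
case: i => // -[//|i] _; apply: (le_trans _ L1).
exact/ltW/mp_Lform_lt.
Qed.

Lemma mp_coord0 i : (1 <= i)%N ->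
  X i <= 2 * (1 + `|xi|) ^+ 3 * `|pt i 0 0|.
Proof.
move=> i1; apply: norm_le_coord0; first exact: mp_norm_ge1.
exact: mp_Lform_le_half.
Qed.

Lemma mp_coord0_neq0 i : (1 <= i)%N -> pt i 0 0 != 0.
Proof.
move=> i1; have := mp_coord0 i1; have := mp_norm_ge1 i1.
by case: eqP => // ->; rewrite normr0 mulr0; lra.
Qed.

Lemma mp_not_colinear i t : (1 <= i)%N -> pt i != t *: pt i.+1.
Proof.
move=> i1; apply/eqP => E.
have t1 : `|t| < 1.
  have : X i < X i.+1 by exact: mp_normS.
  rewrite E normrZ -{2}[X i.+1]mul1r ltr_pM2r //.
  by apply: lt_le_trans (mp_norm_ge1 _).
have := mp_LformS i1; apply/negP; rewrite -leNgt E.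
apply: (le_trans (LformZ _ _ _)); rewrite -[leRHS]mul1r ler_wpM2r //.
  exact: Lform_ge0.
exact: ltW.
Qed.

Lemma mp_free2 i : (1 <= i)%N -> free [:: pt i; pt i.+1].
Proof.
move=> i1.
rewrite free_cons seq1_free real_point_eq0 mp_neq0 // andbT span_seq1.
by apply/vlineP => -[t /eqP]; apply/negP/mp_not_colinear.
Qed.

Lemma mp_minor_neq0 i (u := pt i) (v := pt i.+1) : (1 <= i)%N ->
  (u 0 0 * v 0 1 - u 0 1 * v 0 0 != 0) || (u 0 0 * v 0 2 - u 0 2 * v 0 0 != 0).
Proof.
move=> i1; rewrite -negb_and; apply/negP => /andP[/eqP m /eqP n].
have v0 : v 0 0 != 0 by exact: mp_coord0_neq0.
have /negP := mp_not_colinear (u 0 0 / v 0 0) i1; apply; apply/eqP.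
apply: row3_eq; rewrite [RHS]mxE -/u -/v; first by field.
  by apply: (mulIf v0); apply: (@eqP _ _ _); rewrite -subr_eq0 -oppr_eq0;
    apply/eqP; rewrite -[RHS]m; field.
by apply: (mulIf v0); apply: (@eqP _ _ _); rewrite -subr_eq0 -oppr_eq0;
  apply/eqP; rewrite -[RHS]n; field.
Qed.

(** Two consecutive minimal points generate the integer points of their plane:
    rounding the coordinates of [z] leaves a remainder with coefficients at most
    1/2, which is smaller than [x_{i+1}] and closer than [x_i], hence 0. *)
Lemma mp_lattice i (z : 'rV[int]_3) a b : (1 <= i)%N ->
  real_point R z = a *: pt i + b *: pt i.+1 ->
  exists m n : int, z = m *: x i + n *: x i.+1.
Proof.
move=> i1 Ez.
have round (t : R) : exists m : int, `|t - m%:~R| <= 2^-1.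
  exists (Num.floor (t + 2^-1)); have /andP[] := floor_itv (t + 2^-1).
  by rewrite rmorphD rmorph1 ler_norml => ? ?; apply/andP; split; lra.
have [m Em] := round a; have [n En] := round b; exists m, n.
apply/eqP; rewrite -subr_eq0; apply/negPn/negP => y0.
set y := z - _ in y0.
have Ey : real_point R y = (a - m%:~R) *: pt i + (b - n%:~R) *: pt i.+1.
  apply/rowP => k; move/rowP/(_ k): Ez.
  by rewrite /y !mxE !(rmorphB, rmorphD, rmorphM) /= => ->; ring.
have XS := mp_normS i1; have LS := mp_LformS i1.
have yX : `|real_point R y| < X i.+1.
  rewrite Ey (le_lt_trans (ler_normD _ _)) // !normrZ.
  have := ler_wpM2r (normr_ge0 (pt i)) Em.
  have := ler_wpM2r (normr_ge0 (pt i.+1)) En.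
  by move: XS; lra.
have := mp_min i1 y0 yX; apply/negP; rewrite -ltNge Ey.
apply: (le_lt_trans (Lform_comb _ _ _ _ _)).
have := ler_wpM2r (Lform_ge0 xi (pt i)) Em.
have := ler_wpM2r (Lform_ge0 xi (pt i.+1)) En.
by move: LS; lra.
Qed.

(** Otherwise [y] would be both smaller and closer than [x_i]. *)
Lemma mp_primitive i (y : 'rV[int]_3) (g : int) : (1 <= i)%N -> x i = g *: y ->
  `|g| <= 1.
Proof.
move=> i1 E; rewrite leNgt; apply/negP => g1.
have y0 : y != 0 by apply: contra_neq (mp_neq0 i1) => y0; rewrite E y0 scaler0.
have Ep : pt i = g%:~R *: real_point R y.
  by apply/rowP => k; rewrite E !mxE rmorphM.
have g2 : 2 <= `|g%:~R| :> R.
  by rewrite -intr_norm (ler_int R 2); move: g1; rewrite -lezD1.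
have gu : g%:~R != 0 :> R by apply/eqP => g0; move: g2; rewrite g0 normr0; lra.
have yX : `|real_point R y| <= X i.
  rewrite Ep normrZ -[leLHS]mul1r ler_wpM2r //; lra.
have := mp_min i1 y0 (le_lt_trans yX (mp_normS i1)); apply/negP; rewrite -ltNge.
have {1}-> : real_point R y = g%:~R^-1 *: pt i.
  by rewrite Ep scalerA mulVf ?scale1r.
apply: (le_lt_trans (LformZ _ _ _)).
rewrite -[ltRHS]mul1r ltr_pM2r ?mp_Lform_gt0 // normfV invf_lt1; lra.
Qed.

Lemma mp_dependent_next i : (2 <= i)%N -> ~ indepI R x i ->
  exists m n : int, x i.+1 = m *: x i.-1 + n *: x i.
Proof.
case: i => // i i1 nI.
have nf : ~~ free [:: pt i; pt i.+1; pt i.+2] by apply/negP => f; apply: nI.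
have [a [b]] := elimT (notfree3P _ (mp_free2 (i1 : (1 <= i)%N))) nf.
by move/(mp_lattice i1).
Qed.

(** Between two consecutive elements of [I] the plane spanned by [x_l] and
    [x_{l+1}] does not change. *)
Lemma mp_span i k : (1 <= i)%N -> (i < k)%N ->
  (forall l, (i < l < k)%N -> ~ indepI R x l) ->
  exists m n : int, x k = m *: x i + n *: x i.+1.
Proof.
move=> i1 ik nI.
(* The recursion expresses a point through the two before it. *)
suff: (exists m n : int, x k.-1 = m *: x i + n *: x i.+1) /\
      (exists m n : int, x k = m *: x i + n *: x i.+1) by case.
elim: k ik nI => // k IH; rewrite ltnS leq_eqVlt => /orP[/eqP<- _|ik nI].
  by split; [exists 1, 0|exists 0, 1]; rewrite scale0r scale1r ?addr0 ?add0r.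
have [|[a [b Ea]] [a' [b' Eb]]] := IH ik.
  by move=> l /andP[il lk]; apply: nI; rewrite il ltnW.
split; first by exists a', b'.
have [||m [n ->]] := mp_dependent_next _ (_ : ~ indepI R x k).
- exact: leq_ltn_trans i1 ik.
- by apply: nI; rewrite ik /=.
exists (m * a + n * a'), (m * b + n * b').
by rewrite Ea Eb; apply/rowP => l; rewrite !mxE; ring.
Qed.

End MinimalPoints.

(** * Inequalities between the sizes *)

Section Asymptotics.
Context {R : realType}.
Implicit Types X Y Z W L M K C p a b u E : R.

(** The exponent 9/13 is written with thirteenth powers throughout, so that only
    integer powers occur; 13 - 9 = 4 gives the exponent of [W]. *)
Lemma gap_of_rate X W L M K : 0 <= X -> 0 <= W -> 0 <= L -> 0 <= M -> 0 <= K ->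
  L ^+ 13 * W ^+ 9 <= K -> M ^+ 13 * X ^+ 9 <= K -> 1 <= 6 * (W * L * M) ->
  X ^+ 9 <= 6 ^+ 13 * K ^+ 2 * W ^+ 4.
Proof.
move=> X0 W0 L0 M0 K0 hL hM h1.
have h13 : 1 <= 6 ^+ 13 * (W ^+ 13 * L ^+ 13 * M ^+ 13).
  by rewrite -!exprMn; apply: exprn_ege1.
have hLM : (L ^+ 13 * W ^+ 9) * (M ^+ 13 * X ^+ 9) <= K * K.
  by apply: ler_pM; rewrite // mulr_ge0 ?exprn_ge0.
have := ler_wpM2r (exprn_ge0 9 X0) h13; rewrite mul1r => /le_trans; apply.
have -> : 6 ^+ 13 * (W ^+ 13 * L ^+ 13 * M ^+ 13) * X ^+ 9 =
  6 ^+ 13 * ((L ^+ 13 * W ^+ 9) * (M ^+ 13 * X ^+ 9)) * W ^+ 4 by ring.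
by rewrite ler_wpM2r ?exprn_ge0 // ler_wpM2l ?exprn_ge0 // expr2.
Qed.

Lemma sqr_le_of_gap X W C : 1 <= X -> 0 <= W -> C < X ->
  X ^+ 9 <= C * W ^+ 4 -> X ^+ 2 <= W.
Proof.
move=> X1 W0 CX h.
have X0 : 0 < X by apply: lt_le_trans X1.
suff : (X ^+ 2) ^+ 4 <= W ^+ 4.
  by rewrite ler_pXn2r ?nnegrE ?exprn_ge0 // ltW.
rewrite -exprM -(ler_pM2l X0) -exprS (le_trans h) // ler_wpM2r ?exprn_ge0 //.
exact: ltW.
Qed.

(** Here [a] and [b] stand for [|phi(x)|] and [|phi(y)|], [u] for [|x_0|], [e]
    and [m] for the two error terms in [phi_mul_phi].  The term in [m ^+ 3] is
    absorbed by the second summand since [a] is at most [A X^2 L]. *)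
Lemma root_bound X Y L M p a b u e m A E K0 :
  0 < X -> 0 <= Y -> 0 <= L -> 0 <= M -> 0 <= p -> 0 <= u ->
  0 <= e -> 0 <= m -> 0 <= E -> 0 <= A -> 0 <= K0 ->
  p <= 3 * a -> p <= 3 * b -> a <= A * X ^+ 2 * L -> X <= K0 * u ->
  e <= E * (X ^+ 3 * M + X * Y * L ^+ 2) -> m <= 2 * (Y * L) ->
  4 * a * b * u ^+ 3 <= Y * e ^+ 2 + 4 * a * m ^+ 3 ->
  p ^+ 2 * X <= 9 * K0 ^+ 3 * (E ^+ 2 + 8 * A)
                * (Y * X ^+ 4 * M ^+ 2 + Y ^+ 3 * L ^+ 4).
Proof.
move=> X0 Y0 L0 M0 p0 u0 e0 m0 E0 A0 K00 pa pb aA XK eE mE h.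
have a0 : 0 <= a by move: (le_trans p0 pa); rewrite pmulr_rge0.
have b0 : 0 <= b by move: (le_trans p0 pb); rewrite pmulr_rge0.
set T1 := Y * X ^+ 4 * M ^+ 2; set T2 := Y ^+ 3 * L ^+ 4.
have T10 : 0 <= T1 by rewrite /T1 !mulr_ge0 ?exprn_ge0 // ltW.
have T20 : 0 <= T2 by rewrite /T2 mulr_ge0 ?exprn_ge0.
set S := (T1 + T2) * X ^+ 2.
have h3 : Y * e ^+ 2 <= 2 * (E ^+ 2 * S).
  apply: (@le_trans _ _ (Y * (E * (X ^+ 3 * M + X * Y * L ^+ 2)) ^+ 2)).
    rewrite ler_wpM2l // lerXn2r ?nnegrE //; exact: le_trans eE.
  rewrite -subr_ge0.
  have -> : 2 * (E ^+ 2 * S) - Y * (E * (X ^+ 3 * M + X * Y * L ^+ 2)) ^+ 2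
    = Y * (E * (X ^+ 3 * M - X * Y * L ^+ 2)) ^+ 2.
    by rewrite /S /T1 /T2; ring.
  by rewrite mulr_ge0 // sqr_ge0.
have h4 : a * m ^+ 3 <= 8 * (A * S).
  apply: (@le_trans _ _ (A * X ^+ 2 * L * (2 * (Y * L)) ^+ 3)).
    by apply: ler_pM; rewrite ?exprn_ge0 // lerXn2r ?nnegrE ?mulr_ge0.
  have -> : A * X ^+ 2 * L * (2 * (Y * L)) ^+ 3 = 8 * (A * (T2 * X ^+ 2)).
    by rewrite /T2; ring.
  by rewrite ler_pM2l // ler_wpM2l // ler_wpM2r ?exprn_ge0 ?lerDr // ltW.
have h5 : p ^+ 2 * X ^+ 3 <= 9 * (a * b) * (K0 ^+ 3 * u ^+ 3).
  apply: ler_pM; rewrite ?exprn_ge0 //; first exact: ltW.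
    have -> : 9 * (a * b) = (3 * a) * (3 * b) by ring.
    by rewrite expr2 ler_pM.
  by rewrite -exprMn lerXn2r ?nnegrE ?mulr_ge0 // ltW.
have h7 : a * b * u ^+ 3 <= (E ^+ 2 + 8 * A) * S.
  have : 0 <= E ^+ 2 * S.
    rewrite mulr_ge0 ?exprn_ge0 // /S.
    by rewrite mulr_ge0 ?exprn_ge0 ?addr_ge0 // ltW.
  by move: h h3 h4; lra.
rewrite -(ler_pM2r (exprn_gt0 2 X0)).
have -> : p ^+ 2 * X * X ^+ 2 = p ^+ 2 * X ^+ 3 by ring.
apply: (le_trans h5).
have -> : 9 * (a * b) * (K0 ^+ 3 * u ^+ 3) =
  9 * (K0 ^+ 3 * (a * b * u ^+ 3)) by ring.
have -> : 9 * K0 ^+ 3 * (E ^+ 2 + 8 * A) * (T1 + T2) * X ^+ 2 =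
  9 * (K0 ^+ 3 * ((E ^+ 2 + 8 * A) * S)) by rewrite /S; ring.
by rewrite ler_pM2l // ler_wpM2l ?exprn_ge0.
Qed.

(** [M << Z^(-9/13) <= Y^(-18/13)] turns the hypothesis into
    [1 << X^3 Y^(-23/13)], where [Y >= X^2]. *)
Lemma first_term_bound X Y Z M K C : 1 <= X -> 0 <= M -> 0 <= C ->
  X ^+ 2 <= Y -> Y ^+ 2 <= Z -> M ^+ 13 * Z ^+ 9 <= K ->
  X <= C * (Y * X ^+ 4 * M ^+ 2) -> X <= C ^+ 13 * K ^+ 2.
Proof.
move=> X1 M0 C0 XY YZ hM h.
have X0 : 0 < X by apply: lt_le_trans X1.
have Y0 : 0 <= Y by apply: le_trans XY; rewrite exprn_ge0 // ltW.
have Z0 : 0 <= Z by apply: le_trans YZ; rewrite exprn_ge0.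
have h1 : 1 <= C * (Y * X ^+ 3 * M ^+ 2).
  rewrite -(ler_pM2r X0) mul1r (le_trans h) // le_eqVlt; apply/orP; left.
  by apply/eqP; ring.
have h13 : 1 <= C ^+ 13 * (Y ^+ 13 * X ^+ 39 * M ^+ 26).
  have := exprn_ege1 13 h1.
  by congr (_ <= _); ring.
have hYM : Y ^+ 36 * M ^+ 26 <= K ^+ 2.
  apply: (@le_trans _ _ ((M ^+ 13 * Z ^+ 9) ^+ 2)).
    have -> : Y ^+ 36 * M ^+ 26 = (M ^+ 13 * (Y ^+ 2) ^+ 9) ^+ 2 by ring.
    by rewrite lerXn2r ?nnegrE ?mulr_ge0 ?exprn_ge0 // ler_wpM2l ?exprn_ge0 //
       lerXn2r ?nnegrE ?exprn_ge0.
  by rewrite lerXn2r ?nnegrE // ?(le_trans _ hM) // ?mulr_ge0 ?exprn_ge0.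
have h23 : X ^+ 46 <= Y ^+ 23.
  have -> : X ^+ 46 = (X ^+ 2) ^+ 23 by ring.
  by rewrite lerXn2r ?nnegrE ?exprn_ge0 // ltW.
have h7 : X ^+ 7 <= C ^+ 13 * K ^+ 2.
  rewrite -(ler_pM2r (exprn_gt0 39 X0)) -exprD (le_trans h23) //.
  have := ler_wpM2l (exprn_ge0 23 Y0) h13; rewrite mulr1 => /le_trans; apply.
  have -> : Y ^+ 23 * (C ^+ 13 * (Y ^+ 13 * X ^+ 39 * M ^+ 26)) =
    C ^+ 13 * (Y ^+ 36 * M ^+ 26) * X ^+ 39 by ring.
  by rewrite ler_wpM2r ?exprn_ge0 ?(ltW X0) // ler_wpM2l ?exprn_ge0.
by apply: le_trans h7; apply: ler_eXnr.
Qed.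

(** [L^5 << W^(-45/13)] turns the hypothesis into [W^6 << X^13], whereas
    [X^9 << W^4] gives [X^27 << W^12]. *)
Lemma second_term_bound X W L K C D : 1 <= X -> 0 <= W -> 0 <= L -> 0 <= C ->
  L ^+ 13 * W ^+ 9 <= K -> X ^+ 9 <= D * W ^+ 4 ->
  1 <= C * (W ^+ 3 * X * L ^+ 5) -> X <= D ^+ 3 * (C ^+ 13 * K ^+ 5) ^+ 2.
Proof.
move=> X1 W0 L0 C0 hL hX h1.
have X0 : 0 < X by apply: lt_le_trans X1.
have K0 : 0 <= K by apply: le_trans hL; rewrite mulr_ge0 ?exprn_ge0.
have h13 : 1 <= C ^+ 13 * (W ^+ 39 * X ^+ 13 * L ^+ 65).
  by have := exprn_ege1 13 h1; congr (_ <= _); ring.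
have h6 : W ^+ 6 <= C ^+ 13 * K ^+ 5 * X ^+ 13.
  have := ler_wpM2l (exprn_ge0 6 W0) h13; rewrite mulr1 => /le_trans; apply.
  have -> : W ^+ 6 * (C ^+ 13 * (W ^+ 39 * X ^+ 13 * L ^+ 65)) =
    C ^+ 13 * (L ^+ 13 * W ^+ 9) ^+ 5 * X ^+ 13 by ring.
  rewrite ler_wpM2r ?exprn_ge0 ?(ltW X0) // ler_wpM2l ?exprn_ge0 //.
  by rewrite lerXn2r ?nnegrE ?mulr_ge0 ?exprn_ge0.
have D3 : X ^+ 27 <= D ^+ 3 * (W ^+ 6) ^+ 2.
  have -> : X ^+ 27 = (X ^+ 9) ^+ 3 by ring.
  have -> : D ^+ 3 * (W ^+ 6) ^+ 2 = (D * W ^+ 4) ^+ 3 by ring.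
  have X9 : 0 <= X ^+ 9 by rewrite exprn_ge0 // ltW.
  by rewrite lerXn2r ?nnegrE // (le_trans X9).
have D0 : 0 <= D ^+ 3.
  rewrite exprn_ge0 //; have := exprn_gt0 9 X0; move/lt_le_trans/(_ hX).
  by case: (ltP D 0) => // D0; rewrite ltNge mulr_le0_ge0 ?exprn_ge0 // ltW.
rewrite -(ler_pM2r (exprn_gt0 26 X0)) -exprS (le_trans D3) //.
rewrite -[leRHS]mulrA ler_wpM2l //.
have -> : (C ^+ 13 * K ^+ 5) ^+ 2 * X ^+ 26 =
  (C ^+ 13 * K ^+ 5 * X ^+ 13) ^+ 2 by ring.
have W6 : 0 <= W ^+ 6 by rewrite exprn_ge0.
by rewrite lerXn2r ?nnegrE // (le_trans W6).
Qed.

(** The hypotheses give [X << (X L)^3 << X^(12/13)]: this is where the exponent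
    has to exceed 2/3. *)
Lemma cusp_bound X u L K K0 : 0 < X -> 0 <= L -> 0 <= K0 ->
  L ^+ 13 * X ^+ 9 <= K -> X <= K0 * u -> u <= (2 * (X * L)) ^+ 3 ->
  X <= (8 * K0) ^+ 13 * K ^+ 3.
Proof.
move=> X0 L0 K00 hL XK uL.
have h : X <= 8 * K0 * (X * L) ^+ 3.
  have := le_trans XK (ler_wpM2l K00 uL); congr (_ <= _); ring.
rewrite -(ler_pM2r (exprn_gt0 12 X0)) -exprS.
apply: (@le_trans _ _ ((8 * K0 * (X * L) ^+ 3) ^+ 13)).
  by rewrite lerXn2r ?nnegrE ?(ltW X0) // (le_trans (ltW X0)).
have -> : (8 * K0 * (X * L) ^+ 3) ^+ 13 =
  (8 * K0) ^+ 13 * (L ^+ 13 * X ^+ 9) ^+ 3 * X ^+ 12 by ring.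
rewrite ler_wpM2r ?exprn_ge0 ?(ltW X0) // ler_wpM2l ?exprn_ge0 ?mulr_ge0 //.
have h0 : 0 <= L ^+ 13 * X ^+ 9 by rewrite mulr_ge0 ?exprn_ge0 // ltW.
by rewrite lerXn2r ?nnegrE // (le_trans h0).
Qed.

End Asymptotics.

(** * Consecutive elements of the set of independent indices *)

Lemma succ_inP (S : set nat) (i : nat) : (exists2 j, S j & (i < j)%N) ->
  [/\ S (succ_in S i), (i < succ_in S i)%N
    & forall k, (i < k < succ_in S i)%N -> ~ S k].
Proof.
move=> [j0 Sj0 ij0].
have ex : exists j, `[< S j >] && (i < j)%N.
  by exists j0; rewrite ij0 andbT; apply/asboolP.
have [j /andP[/asboolP Sj ij] jmin] := ex_minnP ex.
rewrite /succ_in; case: xgetP => [l _ [Sl il lmin]|/(_ j)[]]; last first.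
  by split=> // k Sk ik; apply: jmin; rewrite ik andbT; apply/asboolP.
by split=> // k /andP[ik kl] Sk; have := lmin k Sk ik; rewrite leqNgt kl.
Qed.

Section Rate.
Context {R : realType}.
Variables (xi : R) (x : nat -> 'rV[int]_3).
Hypothesis hx : minimal_points xi x.

Local Notation pt i := (real_point R (x i)).
Local Notation X i := (`|pt i|).
Local Notation L i := (Lform xi (pt i)).

(** If the plane of [x_k] and [x_{k+1}] were eventually constant, its normal
    vector [(n0, n1, n2)] would be orthogonal to points whose directions tend to
    that of [(1, xi, xi^3)], hence to that vector. *)
Lemma mp_indep_infinite : lin_indep_Q 1 xi (xi ^+ 3) ->
  forall i, exists2 j, indepI R x j & (i < j)%N.
Proof.
move=> hxi i; apply: contrapT => noI.
have nI k : (i < k)%N -> ~ indepI R x k by move=> ik Ik; apply: noI; exists k.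
set u := x i.+1; set v := x i.+2.
pose n0 := u 0 1 * v 0 2 - u 0 2 * v 0 1.
pose n1 := u 0 2 * v 0 0 - u 0 0 * v 0 2.
pose n2 := u 0 0 * v 0 1 - u 0 1 * v 0 0.
pose t : R := n0%:~R + n1%:~R * xi + n2%:~R * xi ^+ 3.
pose C : R := 2 * (1 + `|xi|) ^+ 3 * (`|n1%:~R| + `|n2%:~R|).
have bound k : (i.+1 < k)%N -> k%:R * `|t| <= C.
  move=> ik.
  have k1 : (1 <= k)%N by apply: leq_trans ik.
  have [a [b Ek]] : exists a b : int, x k = a *: u + b *: v.
    apply: (mp_span hx) => // l /andP[il _]; apply: nI; exact: ltnW.
  have dot : pt k 0 0 * n0%:~R + pt k 0 1 * n1%:~R + pt k 0 2 * n2%:~R = 0.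
    rewrite !mxE -!rmorphM -!rmorphD /= Ek !mxE (_ : _ + _ = 0) //.
    by rewrite /n0 /n1 /n2; ring.
  have [d1 d2] := Lform_ge xi (pt k).
  have L1 := mp_Lform_le_half hx k1.
  have dot' : pt k 0 0 * t = - ((pt k 0 1 - pt k 0 0 * xi) * n1%:~R
      + (pt k 0 2 - pt k 0 0 * xi ^+ 3) * n2%:~R).
    by rewrite /t -[LHS]subr0 -dot; ring.
  have le1 : `|pt k 0 0| * `|t| <= `|n1%:~R| + `|n2%:~R|.
    rewrite -normrM dot' normrN (le_trans (ler_normD _ _)) // !normrM lerD //.
      by rewrite ler_piMl // (le_trans d1) // (le_trans L1) // invf_le1 ?ler1n.
    by rewrite ler_piMl // (le_trans d2) // (le_trans L1) // invf_le1 ?ler1n.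
  apply: (@le_trans _ _ (2 * (1 + `|xi|) ^+ 3 * `|pt k 0 0| * `|t|)).
    rewrite ler_wpM2r // (le_trans (mp_norm_ge hx k1)) //.
    exact: mp_coord0 hx _ k1.
  by rewrite -mulrA ler_wpM2l // mulr_ge0 // exprn_ge0 // addr_ge0.
have t0 : t = 0.
  apply/eqP/negPn/negP => t0.
  have tp : 0 < `|t| by rewrite normr_gt0.
  have := bound (i.+2 + Num.truncn (C / `|t|))%N (leq_addr _ _); apply/negP.
  rewrite -ltNge -ltr_pdivrMr //; apply: lt_le_trans (truncnS_gt _) _.
  by rewrite ler_nat -addn1 addnC leq_add.
have [|_ /eqP m1 /eqP m2] := hxi n0%:~R n1%:~R n2%:~R.
  by rewrite !ratr_int mulr1.
move: m1 m2; rewrite !intr_eq0 => /eqP m1 /eqP m2.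
have := mp_minor_neq0 hx (isT : (1 <= i.+1)%N).
rewrite !mxE -!rmorphM -!rmorphB /= !intr_eq0 -/u -/v.
by rewrite -/n2 m2 eqxx -oppr_eq0 opprB -/n1 m1 eqxx.
Qed.

Lemma mp_indep_det i : indepI R x i -> 1 <= 6 * (X i.+1 * L i * L i.-1).
Proof.
case: i => [|[|i]] [] // _ fr.
have d0 : det3 (x i.+1) (x i.+2) (x i.+3) != 0.
  apply/eqP => d0; move: fr; apply/negP.
  apply/(notfree3P _ (mp_free2 hx (isT : (1 <= i.+1)%N))).
  by apply: det3_eq0_comb; [exact: (mp_minor_neq0 hx)|rewrite det3_real d0].
have d1 : 1 <= `|det3 (pt i.+1) (pt i.+2) (pt i.+3)|.
  by rewrite det3_real -intr_norm (ler_int R 1) -gtz0_ge1 normr_gt0.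
apply: (le_trans d1); apply: det3_le; apply/ltW;
  by [apply: mp_LformS hx _ _|apply: mp_normS hx _ _].
Qed.

Lemma mp_coprime i j p q : (1 <= j)%N -> x j = q *: x i + p *: x i.+1 ->
  coprimez p q.
Proof.
move=> j1 E.
have /dvdzP[p' Ep] := dvdz_gcdl p q; have /dvdzP[q' Eq] := dvdz_gcdr p q.
have E' : x j = gcdz p q *: (q' *: x i + p' *: x i.+1).
  by rewrite E {1}Ep {1}Eq scalerDr !scalerA ![_ * gcdz p q]mulrC.
have := mp_primitive hx j1 E'.
have : gcdz p q != 0.
  by apply: contra_neq (mp_neq0 hx j1) => g0; rewrite E' g0 scale0r.
by rewrite /coprimez /gcdz; case: (gcdn _ _) => [|[|n]].
Qed.

Lemma mp_Lform_le_powR (lambda c X0 : R) i : (1 <= i)%N -> 1 <= X0 ->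
  (exists y : 'rV[int]_3, [/\ y != 0, `|real_point R y| <= X0 &
     Lform xi (real_point R y) <= c * X0 `^ (- lambda)]) ->
  X0 < X i.+1 -> L i <= c * X0 `^ (- lambda).
Proof.
move=> i1 X01 [y [y0 yX yL]] lt_X; apply: le_trans yL.
exact: (mp_min hx i1 y0 (le_lt_trans yX lt_X)).
Qed.

(** 9/13 is a rational number slightly below [(5 - sqrt 13) / 2] for which
    [(9/13) / (1 - 9/13) = 9/4] is simple.  The approximation property is used
    at half of [X_{i+1}], since below norm [X_{i+1}] no point is closer than
    [x_i]. *)
Lemma mp_rate (lambda c : R) : 9 / 13 <= lambda -> 0 <= c ->
  (\forall X \near +oo_R, exists y : 'rV[int]_3,
     [/\ y != 0, `|real_point R y| <= X &
         Lform xi (real_point R y) <= c * X `^ (- lambda)]) ->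
  \forall i \near \oo, L i ^+ 13 * X i.+1 ^+ 9 <= c ^+ 13 * 2 ^+ 9.
Proof.
move=> hl c0 [M [_ hM]].
near=> i.
have i1 : (1 <= i)%N by near: i; exact: nbhs_infty_ge.
have Mi : 2 * M < i%:R by near: i; exact: nbhs_infty_gtr.
have i2 : 2 < i%:R :> R by near: i; exact: nbhs_infty_gtr.
have Xi : i%:R < X i.+1.
  by apply: le_lt_trans (mp_normS hx i1); exact: (mp_norm_ge hx).
set T := X i.+1 / 2.
have EX : X i.+1 = T * 2 by rewrite /T mulfVK.
have T1 : 1 <= T by rewrite /T; lra.
have TX : T < X i.+1 by rewrite /T; lra.
have MT : M < T by rewrite /T; lra.
have T0 : 0 < T by apply: lt_le_trans T1.
have hL := mp_Lform_le_powR i1 T1 (hM _ MT) TX.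
have L0 : 0 <= L i by apply: Lform_ge0.
have hT : (T `^ (- lambda)) ^+ 13 * T ^+ 9 <= 1.
  apply: (@le_trans _ _ ((T `^ (- (9 / 13))) ^+ 13 * T ^+ 9)).
    rewrite ler_wpM2r ?exprn_ge0 ?(ltW T0) // lerXn2r ?nnegrE ?powR_ge0 //.
    by apply: ler_powR => //; rewrite lerN2.
  rewrite -powR_mulrn ?powR_ge0 // -powRrM -(powR_mulrn _ (ltW T0)) -powRD.
    by rewrite (_ : _ + _ = 0) ?powRr0 //; lra.
  by apply/implyP => _; rewrite gt_eqF.
rewrite EX exprMn mulrA ler_wpM2r ?exprn_ge0 //.
apply: (@le_trans _ _ ((c * T `^ (- lambda)) ^+ 13 * T ^+ 9)).
  rewrite ler_wpM2r ?exprn_ge0 ?(ltW T0) // lerXn2r ?nnegrE //.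
  exact: le_trans hL.
by rewrite exprMn -mulrA ler_piMr // exprn_ge0.
Unshelve. all: by end_near.
Qed.

Let K0 : R := 2 * (1 + `|xi|) ^+ 3.

Let K0_ge0 : 0 <= K0.
Proof. by rewrite /K0 mulr_ge0 // exprn_ge0 // addr_ge0. Qed.

(** If [phi (x i)] were 0, the minors of [x i] and [x i.-1], bounded by
    [2 X_i L_{i-1}], would be too small for [cusp_gap]. *)
Lemma mp_phi_neq0 i K : (2 <= i)%N -> L i.-1 ^+ 13 * X i ^+ 9 <= K ->
  (8 * K0) ^+ 13 * K ^+ 3 < X i -> phi (x i) != 0.
Proof.
case: i => // -[//|i] _ /= hK; rewrite ltNge; apply: contraNneq => phi0.
have X0 : 0 < X i.+2 by apply: lt_le_trans (mp_norm_ge1 hx _).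
have L0 : 0 <= L i.+1 by apply: Lform_ge0.
have u0 : x i.+2 0 0 != 0.
  by have := mp_coord0_neq0 hx (isT : (1 <= i.+2)%N); rewrite mxE intr_eq0.
apply: (cusp_bound X0 L0 K0_ge0 hK (mp_coord0 hx _)) => //.
set w := x i.+1; set v := x i.+2.
pose m := v 0 0 * w 0 1 - v 0 1 * w 0 0.
pose n := v 0 0 * w 0 2 - v 0 2 * w 0 0.
have mn : (m != 0) || (n != 0).
  have := mp_minor_neq0 hx (isT : (1 <= i.+1)%N).
  rewrite !mxE -!rmorphM -!rmorphB /= !intr_eq0 -/v -/w.
  have -> : w 0 0 * v 0 1 - w 0 1 * v 0 0 = - m by rewrite /m; ring.
  have -> : w 0 0 * v 0 2 - w 0 2 * v 0 0 = - n by rewrite /n; ring.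
  by rewrite !oppr_eq0.
have minor k : k = 1 \/ k = 2 ->
    `|v 0 0 * w 0 k - v 0 k * w 0 0|%:~R <= 2 * (X i.+2 * L i.+1).
  move=> k12; have := minor_le xi (pt i.+2) (pt i.+1) k12.
  rewrite !mxE -!rmorphM -!rmorphB /= -intr_norm => /le_trans; apply.
  rewrite (mulrDl 1 1) mul1r lerD2l ler_pM ?Lform_ge0 //; apply/ltW.
    exact: (mp_normS hx).
  exact: (mp_LformS hx).
have mnL : (Num.max `|m| `|n|)%:~R <= 2 * (X i.+2 * L i.+1).
  by case: (leP `|m| `|n|) => _; apply: minor; [right|left].
rewrite mxE -intr_norm -/v.
apply: (@le_trans _ _ ((Num.max `|m| `|n|)%:~R ^+ 3)).
  by rewrite -rmorphXn ler_int; apply: cusp_gap.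
by rewrite lerXn2r ?nnegrE ?mulr_ge0 ?ler0z ?le_max ?normr_ge0.
Qed.

(** The minors of [x i] and [x j] are [p] times those of [x i] and [x i.+1]; the
    former reach about [X_j L_i] and the latter are at most [2 X_{i+1} L_i]. *)
Lemma mp_index_ge i j p q : (1 <= i)%N -> (i < j)%N ->
  x j = q *: x i + p *: x i.+1 -> 2 * K0 < X i -> X i ^+ 2 <= X j ->
  X j <= 4 * K0 * `|p|%:~R * X i.+1.
Proof.
move=> i1 ij E K0X XX.
have X1 := mp_norm_ge1 hx i1.
have j1 : (1 <= j)%N by apply: ltn_trans ij.
have Li := mp_Lform_gt0 hx i1.
have minor k : k = 1 \/ k = 2 ->
    `|pt i 0 0 * pt j 0 k - pt i 0 k * pt j 0 0|
      <= `|p|%:~R * (2 * (X i.+1 * L i)).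
  move=> k12.
  have -> : pt i 0 0 * pt j 0 k - pt i 0 k * pt j 0 0 =
      p%:~R * (pt i 0 0 * pt i.+1 0 k - pt i 0 k * pt i.+1 0 0).
    by rewrite E real_point_comb !mxE; ring.
  rewrite normrM -intr_norm ler_wpM2l ?ler0z //.
  apply: (le_trans (minor_le xi _ _ k12)).
  rewrite addrC (mulrDl 1 1) mul1r lerD2l ler_pM ?Lform_ge0 //; apply/ltW.
    exact: (mp_normS hx).
  exact: (mp_LformS hx).
have h : `|pt j 0 0| * L i <= X i * L i + `|p|%:~R * (2 * (X i.+1 * L i)).
  apply: (le_trans (minor_ge xi (pt i) (pt j))); apply: lerD.
    by rewrite ler_wpM2l // ltW // (mp_Lform_lt hx).
  by rewrite ge_max !minor; [|right|left].
have h' : `|pt j 0 0| <= X i + `|p|%:~R * (2 * X i.+1).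
  rewrite -(ler_pM2r Li) (le_trans h) // le_eqVlt; apply/orP; left.
  by apply/eqP; ring.
have XK : X j <= K0 * (X i + `|p|%:~R * (2 * X i.+1)).
  exact: le_trans (mp_coord0 hx j1) (ler_wpM2l K0_ge0 h').
have : 2 * K0 * X i <= X i ^+ 2 by rewrite expr2 ler_wpM2r // ltW.
by move: XK XX; lra.
Qed.

(** [K] bounds [L_k^13 X_{k+1}^9], [D] is the constant of [gap_of_rate], [C1]
    that of [root_bound], and [C2] the one left after eliminating [p] and
    [X_j].  The lower bounds on [X_i] are those at which [mp_index_ge],
    [sqr_le_of_gap], [mp_phi_neq0], [first_term_bound] and [second_term_bound]
    become effective. *)
Lemma mp_Fform_neq0 K i j (D := 6 ^+ 13 * K ^+ 2)
  (C1 := 9 * K0 ^+ 3 * ((15 * (1 + `|xi|) ^+ 2) ^+ 2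
                        + 8 * (8 * (1 + `|xi|) ^+ 2)))
  (C2 := 32 * K0 ^+ 2 * C1 * (12 * K0 * (8 * (1 + `|xi|) ^+ 2))) :
  indepI R x i -> indepI R x j -> (i < j)%N ->
  (forall k, (i < k < j)%N -> ~ indepI R x k) ->
  (forall k, (i.-1 <= k)%N -> L k ^+ 13 * X k.+1 ^+ 9 <= K) ->
  2 * K0 < X i -> D < X i -> (8 * K0) ^+ 13 * K ^+ 3 < X i ->
  (2 * C1) ^+ 13 * K ^+ 2 < X i ->
  D ^+ 3 * (C2 ^+ 13 * K ^+ 5) ^+ 2 < X i ->
  Fform (x i) (x j) != 0.
Proof.
move=> Ii Ij ij nI rate bK bD bcusp b1 b2.
have i2 : (2 <= i)%N by case: Ii.
have i1 : (1 <= i)%N by apply: ltnW.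
have j1 : (1 <= j)%N by apply: ltn_trans ij.
have j2 : (2 <= j)%N by apply: leq_trans ij.
have iE : i.-1.+1 = i by rewrite prednK.
have jE : j.-1.+1 = j by rewrite prednK.
have ij' : (i.-1 <= j.-1)%N by rewrite -ltnS jE (leq_ltn_trans (leq_pred i)).
have X1 := mp_norm_ge1 hx i1; have Xij := mp_norm_lt hx i1 ij.
have Lij := mp_Lform_lt hx i1 ij.
have W0 : 0 <= X i.+1 by exact: normr_ge0.
have L0 k : 0 <= L k by apply: Lform_ge0.
have ri := rate i (leq_pred i).
have rj := rate j (leq_trans (leq_pred i) (ltnW ij)).
have ri' := rate i.-1 (leqnn _); have rj' := rate j.-1 ij'.
rewrite iE in ri'; rewrite jE in rj'.
have Kp : 0 <= K by apply: le_trans ri; rewrite mulr_ge0 ?exprn_ge0.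
have gi := gap_of_rate (normr_ge0 _) (normr_ge0 _) (L0 _) (L0 _) Kp ri ri'
  (mp_indep_det Ii).
have gj := gap_of_rate (normr_ge0 _) (normr_ge0 _) (L0 _) (L0 _) Kp rj rj'
  (mp_indep_det Ij).
have XW := sqr_le_of_gap X1 W0 bD gi.
have YZ := sqr_le_of_gap (mp_norm_ge1 hx j1) (normr_ge0 _) (lt_trans bD Xij) gj.
have WY : X i.+1 <= X j.
  move: ij; rewrite leq_eqVlt => /orP[/eqP->|ij1] //.
  exact/ltW/(mp_norm_lt hx).
have XY := le_trans XW WY.
have phii := mp_phi_neq0 i2 ri' bcusp.
have phij := mp_phi_neq0 j2 rj' (lt_trans bcusp Xij).
apply/eqP => F0.
have [q [p E]] := mp_span hx i1 ij nI.
have [dvi dvj] : (p %| 3 * phi (x i))%Z /\ (p %| 3 * phi (x j))%Z.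
  by rewrite E; apply: dvdz_3phi; rewrite -?E //; apply: mp_coprime E.
have YpW := mp_index_ge i1 ij E bK XY.
set P : R := `|p|%:~R in YpW.
have P1 : 1 <= P.
  rewrite (ler_int R 1) -gtz0_ge1 normr_gt0; apply/eqP => p0.
  move: YpW; rewrite /P p0 normr0 mulr0 mul0r leNgt.
  by rewrite (lt_le_trans _ (mp_norm_ge1 hx j1)).
have P0 : 0 <= P by apply: le_trans P1.
have dvd_le k : phi (x k) != 0 -> (p %| 3 * phi (x k))%Z ->
    P <= 3 * `|phi (pt k)|.
  move=> n0 dv; rewrite phi_real -intr_norm.
  rewrite -(rmorph_nat intr 3) -rmorphM /= ler_int.
  rewrite -[leRHS](_ : `|3 * phi (x k)| = _); last by rewrite normrM.
  by apply: ler_absz_dvd => //; rewrite mulf_neq0.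
have Pi := dvd_le _ phii dvi; have Pj := dvd_le _ phij dvj.
have LX : L i <= X i.
  apply: (le_trans (mp_Lform_le_half hx i1)); apply: le_trans X1.
  by rewrite invf_le1 ?ler1n.
have aA := phi_le LX.
have eE := double_root_le (ltW Lij) LX (ltW Xij).
have mE : `|pt j 0 0 * pt i 0 1 - pt i 0 0 * pt j 0 1| <= 2 * (X j * L i).
  have := minor_le xi (pt j) (pt i) (or_introl erefl).
  rewrite (mulrC (pt j 0 1)) => /le_trans; apply.
  by rewrite (mulrDl 1 1) mul1r lerD2l ler_pM ?Lform_ge0 // ltW.
have F0' : Fform (pt i) (pt j) = 0.
  rewrite /Fform !phi_real !Phi_real -(rmorph_nat intr 4).
  by rewrite -rmorphXn -!rmorphM -rmorphB /= -[RHS](_ : 0%:~R = _) // -F0.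
have idF := phi_mul_phi (pt i) (pt j).
rewrite F0' mulr0 subr0 in idF.
have B0 : 0 <= (1 + `|xi|) ^+ 2 by rewrite exprn_ge0 // addr_ge0.
have h : P ^+ 2 * X i <=
    C1 * (X j * X i ^+ 4 * L j ^+ 2 + X j ^+ 3 * L i ^+ 4).
  have X0 : 0 < X i by apply: lt_le_trans X1.
  apply: (root_bound X0 _ _ _ _ _ _ _ _ _ K0_ge0 Pi Pj aA
    (mp_coord0 hx i1) eE mE) => //; rewrite ?mulr_ge0 //.
  have -> : 4 * `|phi (pt i)| * `|phi (pt j)| * `|pt i 0 0| ^+ 3
    = `|4 * phi (pt i) * phi (pt j) * pt i 0 0 ^+ 3|.
    by rewrite (normrM _ (_ ^+ 3)) normrX 2!normrM normr_nat.
  rewrite idF (le_trans (ler_normD _ _)) // lerD //.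
    by rewrite normrM normrX ler_wpM2r ?exprn_ge0 // norm_coord_le.
  by rewrite (normrM _ (_ ^+ 3)) normrX normrM normr_nat.
have C10 : 0 <= C1.
  by rewrite /C1 !mulr_ge0 ?exprn_ge0 // addr_ge0 // ?exprn_ge0 ?mulr_ge0.
have XP : X i <= P ^+ 2 * X i by rewrite ler_peMl // exprn_ege1.
set T1 := X j * X i ^+ 4 * L j ^+ 2 in h; set T2 := X j ^+ 3 * L i ^+ 4 in h.
(* Whichever summand of [h] dominates, [X i] is bounded. *)
have [T12|/ltW T12] := leP T2 T1.
  move: b1; apply/negP; rewrite -leNgt.
  apply: (first_term_bound X1 (L0 j) _ XY YZ rj); first by rewrite mulr_ge0.
  apply: (le_trans (le_trans XP h)).
  by have := ler_wpM2l C10 T12; rewrite -/T1; lra.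
move: b2; apply/negP; rewrite -leNgt.
have A0 : 0 <= 8 * (1 + `|xi|) ^+ 2 by rewrite mulr_ge0.
apply: (second_term_bound X1 W0 (L0 i) _ ri gi).
  by rewrite /C2 !mulr_ge0 ?exprn_ge0.
have Y0 : 0 < X j by apply: lt_le_trans (mp_norm_ge1 hx j1).
have X0 : 0 < X i by apply: lt_le_trans X1.
have h2 : X i <= 32 * K0 ^+ 2 * C1 * (X i.+1 ^+ 2 * X j * L i ^+ 4).
  rewrite -(ler_pM2l (exprn_gt0 2 Y0)).
  apply: (@le_trans _ _ ((4 * K0 * P * X i.+1) ^+ 2 * X i)).
    by rewrite ler_wpM2r // lerXn2r ?nnegrE ?mulr_ge0.
  have -> : (4 * K0 * P * X i.+1) ^+ 2 * X i =
    16 * K0 ^+ 2 * X i.+1 ^+ 2 * (P ^+ 2 * X i) by ring.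
  have -> : X j ^+ 2 * (32 * K0 ^+ 2 * C1 * (X i.+1 ^+ 2 * X j * L i ^+ 4)) =
    16 * K0 ^+ 2 * X i.+1 ^+ 2 * (2 * C1 * T2) by rewrite /T2; ring.
  rewrite ler_wpM2l ?mulr_ge0 ?exprn_ge0 // (le_trans h) //.
  by have := ler_wpM2l C10 T12; lra.
have h3 : X j <= 12 * K0 * (8 * (1 + `|xi|) ^+ 2) * (X i ^+ 2 * L i * X i.+1).
  apply: (le_trans YpW).
  have P3 := le_trans Pi (ler_wpM2l (ler0n R 3) aA).
  by have := ler_wpM2l K0_ge0 (ler_wpM2r W0 P3); lra.
rewrite -(ler_pM2r X0) mul1r (le_trans h2) //.
have -> : C2 * (X i.+1 ^+ 3 * X i * L i ^+ 5) * X i =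
  32 * K0 ^+ 2 * C1 * (X i.+1 ^+ 2 * (12 * K0 * (8 * (1 + `|xi|) ^+ 2)
     * (X i ^+ 2 * L i * X i.+1)) * L i ^+ 4) by rewrite /C2; ring.
rewrite ler_wpM2l ?mulr_ge0 ?exprn_ge0 // ler_wpM2r ?exprn_ge0 //.
by rewrite ler_wpM2l ?exprn_ge0.
Qed.

End Rate.

Theorem theorem5p2 (R : realType) (xi lambda c : R) (x : nat -> 'rV[int]_3)
  (hxi : lin_indep_Q 1 xi (xi ^+ 3))
  (hlambda : 0 < lambda) (hc : 0 < c)
  (happrox : \forall X \near +oo_R, exists y : 'rV[int]_3,
     [/\ y != 0, `|real_point R y| <= X &
         Lform xi (real_point R y) <= c * X `^ (- lambda)])
  (hx : minimal_points xi x)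
  (hlarge : (5 - Num.sqrt 13) / 2 < lambda) :
  \forall i \near \oo, indepI R x i -> Fseq R x i != 0.
Proof.
(* 47/13 is the value of the square root at which the bound becomes 9/13. *)
have l913 : 9 / 13 <= lambda.
  have : Num.sqrt 13 <= 47 / 13 :> R.
    rewrite -(@ger0_norm R (47 / 13)) // -sqrtr_sqr ler_wsqrtr //.
    rewrite exprMn exprVn; lra.
  by move: hlarge; lra.
have [N _ rate] := mp_rate hx l913 (ltW hc) happrox.
near=> i => Ii.
have i2 : (2 <= i)%N by case: Ii.
have iX : i%:R <= `|real_point R (x i)| by apply: (mp_norm_ge hx); apply: ltnW.
have [Ij ij nI] := succ_inP (mp_indep_infinite hx hxi i).
apply: (mp_Fform_neq0 hx Ii Ij ij nI) => [k ik|||||].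
- apply: rate; rewrite /= (leq_trans _ ik) // -ltnS prednK ?(ltnW i2) //.
  by near: i; exact: nbhs_infty_ge.
all: by apply: lt_le_trans iX; near: i; exact: nbhs_infty_gtr.
Unshelve. all: by end_near.
Qed.
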